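(* Let $n\ge 1$ and let $\mathcal{S}_n$ denote the class of convex bodies in $\mathbb{R}^n$ that are intersections of Euclidean unit balls, equipped with the Hausdorff distance $\delta$. Let $T:\mathcal{S}_n\to\mathcal{S}_n$ be a bijective isometry with respect to $\delta$. Then there exists a rigid motion $g:\mathbb{R}^n\to\mathbb{R}^n$ such that either $TK=gK$ for all $K\in\mathcal{S}_n$, or $TK=gK^c$ for all $K\in\mathcal{S}_n$.
   Context: A convex body is a compact, convex, non-empty subset of $\mathbb{R}^n$; $\mathbb{R}^n$ carries the Euclidean inner product and norm $\|\cdot\|_2$, and $B_2^n$ is the closed Euclidean unit ball. The Hausdorff distance between convex bodies is $\delta(K_0,K_1)=\inf\{\lambda>0: K_0\subseteq K_1+\lambda B_2^n,\ K_1\subseteq K_0+\lambda B_2^n\}$. $\mathcal{S}_n$ is the set of convex bodies which are intersections of (translates of) Euclidean unit balls. For $K\in\mathcal{S}_n$, the $c$-dual is $K^c=\bigcap_{x\in K}(x+B_2^n)$, equivalently the unique $L\in\mathcal{S}_n$ with $K-L=B_2^n$ (support function $h_{K^c}(u)=1-h_K(-u)$). *)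

(* Defs.v *)
From HB Require Import structures.
From mathcomp Require Import all_boot all_order all_algebra.
From mathcomp Require Import all_classical all_reals topology normedtype.
Set Implicit Arguments. Unset Strict Implicit. Unset Printing Implicit Defensive.
Import Order.TTheory GRing.Theory Num.Theory.
Import numFieldNormedType.Exports.
Local Open Scope classical_set_scope.
Local Open Scope ring_scope.

Section BallBodies.
Variables (R : realType) (n : nat).
Local Notation V := 'rV[R]_n.

Definition dotp (u v : V) : R := \sum_(i < n) u 0 i * v 0 i.
Definition enorm (u : V) : R := Num.sqrt (dotp u u).

Definition convex_set (K : set V) : Prop :=
  forall x y t, K x -> K y -> 0 <= t -> t <= 1 -> K ((1 - t) *: x + t *: y).
Definition convex_body (K : set V) : Prop :=
  compact K /\ convex_set K /\ K !=set0.

Definition parallel_body (K : set V) (lam : R) : set V :=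
  [set x | exists2 y, K y & enorm (x - y) <= lam].

Definition hausdorff (K0 K1 : set V) : R :=
  inf [set lam : R | 0 < lam /\ K0 `<=` parallel_body K1 lam
                            /\ K1 `<=` parallel_body K0 lam].

Definition unit_ball (a : V) : set V := [set x | enorm (x - a) <= 1].

Definition ball_body (K : set V) : Prop :=
  convex_body K /\ exists A : set V, K = \bigcap_(a in A) unit_ball a.

Definition cdual (K : set V) : set V := \bigcap_(x in K) unit_ball x.

Definition rigid_motion (g : V -> V) : Prop :=
  exists (U : 'M[R]_n) (b : V), U *m U^T = 1%:M /\ forall x, g x = x *m U + b.

End BallBodies.

(* Main.v *)
Require Import Defs.
From HB Require Import structures.
From mathcomp Require Import all_boot all_order all_algebra.
From mathcomp Require Import all_classical all_reals topology normedtype.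
From mathcomp Require Import derive realfun.
From mathcomp Require Import ring lra.
Import Order.TTheory GRing.Theory Num.Theory.
Import numFieldNormedType.Exports.
Local Open Scope classical_set_scope.
Local Open Scope ring_scope.
Set Implicit Arguments.
Unset Strict Implicit.

(**
  Say that K has a square if there are ball bodies L1, L2, L3, L4 at distance at
  most 2 from K, cyclically at distance 4 from one another, with L1 <> L3 and
  L2 <> L4. This is a metric notion, so K has a square if T K does. If K is
  neither a point nor a unit ball and p maximizes the unit direction u on K, then
  K lies in the unit ball centered at p - u, and K + 2u, {p - 2u}, p + u + B,
  K - 2u is a square. Around a point x, two bodies at distance 4 must be {a} and a
  body containing 2x - a, for some a on the sphere of radius 2 about x; a ball body
  in the ball of radius 2 meets that sphere at most once, so a point has no squares.

  Hence T maps points to points and unit balls, all of one kind, since a point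
  and a unit ball are at distance at least 1. The induced map g of the space is a
  Euclidean isometry. If points go to points, T K = g K because K is determined
  by the centers of the unit balls containing it. If points go to unit balls,
  T K = g K^c because x lies in a ball body M if and only if the unit ball
  centered at x is at distance at most 1 from M.
*)

Ltac vec := apply/rowP => ?; rewrite !mxE; lra.

(** * Euclidean norm and compactness *)

Section Euclid.
Variables (R : realType) (n : nat).
Implicit Types (u v w x y z : 'rV[R]_n) (K L M : set 'rV[R]_n).

Lemma dotpC u v : dotp u v = dotp v u.
Proof. by apply: eq_bigr => i _; rewrite mulrC. Qed.

Lemma dotpDl u v w : dotp (u + v) w = dotp u w + dotp v w.
Proof. by rewrite -big_split; apply: eq_bigr => i _; rewrite !mxE mulrDl. Qed.

Lemma dotpZl (a : R) u v : dotp (a *: u) v = a * dotp u v.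
Proof. by rewrite mulr_sumr; apply: eq_bigr => i _; rewrite !mxE mulrA. Qed.

Lemma dotpNl u v : dotp (- u) v = - dotp u v.
Proof. by rewrite -scaleN1r dotpZl mulN1r. Qed.

Lemma dotpDr u v w : dotp w (u + v) = dotp w u + dotp w v.
Proof. by rewrite dotpC dotpDl !(dotpC w). Qed.

Lemma dotpZr (a : R) u v : dotp v (a *: u) = a * dotp v u.
Proof. by rewrite dotpC dotpZl dotpC. Qed.

Lemma dotpNr u v : dotp v (- u) = - dotp v u.
Proof. by rewrite dotpC dotpNl dotpC. Qed.

Lemma dotp0l u : dotp 0 u = 0.
Proof. by rewrite -(scale0r u) dotpZl mul0r. Qed.

Definition dotpE := (dotpDl, dotpDr, dotpZl, dotpZr, dotpNl, dotpNr).

Lemma dotp_ge0 u : 0 <= dotp u u.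
Proof. by apply: sumr_ge0 => i _; rewrite -expr2 sqr_ge0. Qed.

Lemma dotp_le0 u : dotp u u <= 0 -> u = 0.
Proof.
move=> u0; have /eqP : dotp u u = 0 by apply/eqP; rewrite eq_le u0 dotp_ge0.
rewrite psumr_eq0 => [/allP u00|i _]; last by rewrite -expr2 sqr_ge0.
apply/rowP => i; rewrite mxE; apply/eqP.
by have := u00 i (mem_index_enum i); rewrite /= -expr2 sqrf_eq0.
Qed.

Lemma enorm_ge0 u : 0 <= enorm u. Proof. exact: sqrtr_ge0. Qed.

Lemma sqr_enorm u : enorm u ^+ 2 = dotp u u.
Proof. by rewrite sqr_sqrtr ?dotp_ge0. Qed.

Lemma enorm_le u (d : R) : 0 <= d -> (enorm u <= d) = (dotp u u <= d ^+ 2).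
Proof. by move=> d0; rewrite -sqr_enorm ler_pXn2r ?nnegrE ?enorm_ge0. Qed.

Lemma enorm_ge u (d : R) : 0 <= d -> (d <= enorm u) = (d ^+ 2 <= dotp u u).
Proof. by move=> d0; rewrite -sqr_enorm ler_pXn2r ?nnegrE ?enorm_ge0. Qed.

Lemma enorm_eq u (d : R) : 0 <= d -> dotp u u = d ^+ 2 -> enorm u = d.
Proof. by move=> d0 ud; apply: le_anti; rewrite enorm_le // enorm_ge // ud lexx. Qed.

Lemma enormN u : enorm (- u) = enorm u.
Proof. by rewrite /enorm dotpNl dotpNr opprK. Qed.

Lemma enormB u v : enorm (u - v) = enorm (v - u).
Proof. by rewrite -enormN opprB. Qed.

Lemma enorm0 : enorm (0 : 'rV[R]_n) = 0.
Proof. by apply: enorm_eq; rewrite // dotp0l expr0n. Qed.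

Lemma enorm_unit_scale u (a : R) : dotp u u = 1 -> 0 <= a -> enorm (a *: u) = a.
Proof. by move=> u1 a0; apply: enorm_eq => //; rewrite !dotpE u1 mulr1. Qed.

Lemma dotp_le_enorm u v : dotp u v <= enorm u * enorm v.
Proof.
have u0 := enorm_ge0 u; have v0 := enorm_ge0 v.
have [uv0|uv0] := eqVneq (enorm u * enorm v) 0.
  have [/eqP u0'|/eqP v0'] : enorm u == 0 \/ enorm v == 0.
    by apply/orP; rewrite -mulf_eq0 uv0.
  - have -> : u = 0 by apply: dotp_le0; rewrite -sqr_enorm u0' expr0n.
    by rewrite enorm0 mul0r dotp0l.
  - have -> : v = 0 by apply: dotp_le0; rewrite -sqr_enorm v0' expr0n.
    by rewrite enorm0 mulr0 dotpC dotp0l.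
have uvp : 0 < enorm u * enorm v by rewrite lt_neqAle eq_sym uv0 mulr_ge0.
(* The square expands to [2 |u| |v| (|u| |v| - dotp u v)], and the factor [|u| |v|] is positive
   here. *)
have := dotp_ge0 (enorm v *: u - enorm u *: v).
rewrite !dotpE (dotpC v u) -!sqr_enorm => h.
rewrite -(ler_pM2l uvp); lra.
Qed.

Lemma enormD u v : enorm (u + v) <= enorm u + enorm v.
Proof.
have u0 := enorm_ge0 u; have v0 := enorm_ge0 v.
rewrite enorm_le ?addr_ge0 // !dotpE (dotpC v u) -!sqr_enorm.
have := dotp_le_enorm u v; lra.
Qed.

Lemma enorm_triangle y x z : enorm (x - z) <= enorm (x - y) + enorm (y - z).
Proof. by have := enormD (x - y) (y - z); rewrite addrA subrK. Qed.

Lemma enorm_eq0 u : enorm u <= 0 -> u = 0.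
Proof. by rewrite enorm_le // expr0n /=; exact: dotp_le0. Qed.

Lemma dotp_continuous (f g : 'rV[R]_n -> 'rV[R]_n) :
  continuous f -> continuous g -> continuous (fun x => dotp (f x) (g x)).
Proof.
move=> fc gc.
have cc h i : continuous h -> continuous (fun y => (h y : 'rV[R]_n) 0 i).
  move=> hc y; apply: (@continuous_comp _ _ _ h (fun w : 'rV[R]_n => w 0 i) y);
    [exact: hc|exact: coord_continuous].
rewrite /dotp; apply: (continuous_big (op := +%R)) => [|i _]; first exact: add_continuous.
by move=> x; exact: (continuousM (cc f i fc x) (cc g i gc x)).
Qed.

Lemma enorm_continuous x : continuous (fun y => enorm (y - x)).
Proof.
have bc : continuous (fun y => y - x).
  by move=> y; apply: continuousB => //; exact: cst_continuous.
move=> y; apply: (@continuous_comp _ _ _ (fun y => dotp (y - x) (y - x)) Num.sqrt);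
  last exact: sqrt_continuous.
exact: dotp_continuous.
Qed.

Lemma nearest M x : compact M -> M !=set0 ->
  exists2 m, M m & forall m', M m' -> enorm (x - m) <= enorm (x - m').
Proof.
move=> Mc M0.
have /(EVT_min_rV M0 Mc)[m] :
    {within M, continuous (fun y => enorm (y - x))}.
  by apply: continuous_subspaceT; exact: enorm_continuous.
rewrite inE => Mm mmin; exists m => // m' Mm'.
by rewrite enormB (enormB x); apply: mmin; rewrite inE.
Qed.

Lemma farthest K u : compact K -> K !=set0 ->
  exists2 p, K p & forall y, K y -> dotp y u <= dotp p u.
Proof.
move=> Kc K0.
have /(EVT_max_rV K0 Kc)[m] :
    {within K, continuous (fun y => dotp y u)}.
  apply: continuous_subspaceT.
  by apply: (dotp_continuous (f := id) (g := fun=> u)) => y;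
    [exact: cvg_id|exact: cst_continuous].
by rewrite inE => Mm mmin; exists m => // m' Mm'; apply: mmin; rewrite inE.
Qed.

(** The distance to [M] is 1-Lipschitz, so it attains its maximum on the compact set [K]. Pointwise
    strict bounds therefore become one uniform bound that is still strict. *)
Lemma compact_parallel K M (d : R) :
    compact K -> K !=set0 -> compact M -> M !=set0 ->
    (forall y, K y -> exists2 m, M m & enorm (y - m) < d) ->
  exists2 e, e < d & K `<=` parallel_body M e.
Proof.
move=> Kc K0 Mc M0 KM.
have /choice[f fP] : forall x, exists m,
    M m /\ forall m', M m' -> enorm (x - m) <= enorm (x - m').
  by move=> x; have [m] := nearest x Mc M0; exists m.
have lip x y : enorm (x - f x) <= enorm (y - f y) + enorm (x - y).
  rewrite [leRHS]addrC; apply: le_trans (enorm_triangle _ _ _).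
  by have [_] := fP x; apply; have [] := fP y.
have /(EVT_max_rV K0 Kc)[y] : {within K, continuous (fun y => enorm (y - f y))}.
  apply: continuous_subspaceT => y.
  apply/(@cvgrPdist_lt _ _ _ (nbhs y) (nbhs_filter y)) => e e0.
  have := @enorm_continuous y y; rewrite /continuous_at subrr enorm0.
  move/(@cvgrPdist_lt _ _ _ (nbhs y) (nbhs_filter y)) => /(_ e e0); apply: filterS => z.
  rewrite sub0r normrN ger0_norm ?enorm_ge0 // => ze.
  apply: le_lt_trans ze; rewrite ler_norml; apply/andP; split.
    by have := lip z y; lra.
  by have := lip y z; rewrite (enormB y z); lra.
rewrite inE => Ky ymax; exists (enorm (y - f y)).
  have [m Mm ym] := KM _ Ky; apply: le_lt_trans ym.
  by have [_] := fP y; exact.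
move=> z Kz; exists (f z); first by have [] := fP z.
by apply: ymax; rewrite inE.
Qed.

Lemma unit_ball_compact x : compact (unit_ball x).
Proof.
have box : compact [set v : 'rV[R]_n |
    forall i, `[x 0 i - 1, x 0 i + 1]%classic (v ord0 i)].
  by apply: (@rV_compact _ _ (fun i => `[x 0 i - 1, x 0 i + 1]%classic)) => i;
    exact: segment_compact.
apply: subclosed_compact box _.
  rewrite (_ : unit_ball x = (fun y => enorm (y - x)) @^-1` [set r | r <= 1]) //.
  by apply: closed_comp => [y _|]; [exact: enorm_continuous|exact: closed_le].
move=> y; rewrite /unit_ball /= enorm_le // expr1n => yx i.
have : ((y - x) 0 i) ^+ 2 <= 1.
  apply: le_trans yx; rewrite /dotp (bigD1 i) //= -expr2 lerDl.
  by apply: sumr_ge0 => j _; rewrite -expr2 sqr_ge0.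
by rewrite !mxE in_itv /= => h; apply/andP; split; nra.
Qed.

End Euclid.

(** * Hausdorff distance of compact sets *)

Section Hausdorff.
Variables (R : realType) (n : nat).
Implicit Types (u v w x y z : 'rV[R]_n) (K L M : set 'rV[R]_n).

Definition near_within K L (d : R) :=
  K `<=` parallel_body L d /\ L `<=` parallel_body K d.

Lemma near_withinC K L d : near_within K L d -> near_within L K d.
Proof. by case. Qed.

Lemma near_within_trans L K M d e :
  near_within K L d -> near_within L M e -> near_within K M (d + e).
Proof.
move=> [KL LK] [LM ML]; split=> [y /KL[z /LM[m Mm zm] yz]|y /ML[z /LK[m Km zm] yz]].
  by exists m => //; apply: le_trans (enorm_triangle z _ _) (lerD yz zm).
exists m => //; rewrite [leRHS]addrC.
by apply: le_trans (enorm_triangle z _ _) (lerD yz zm).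
Qed.

Lemma hausdorffC K L : hausdorff K L = hausdorff L K.
Proof. by congr inf; apply/seteqP; split=> l /= [? [? ?]]. Qed.

Lemma compact_near_within K L :
    compact K -> K !=set0 -> compact L -> L !=set0 ->
  exists2 d, 0 < d & near_within K L d.
Proof.
move=> Kc K0 Lc L0.
have [k Kk] := K0; have [l Ll] := L0.
have bnd M y : compact M -> M !=set0 ->
    exists2 d, 0 <= d & forall m, M m -> enorm (m - y) <= d.
  move=> Mc M0.
  have /(EVT_max_rV M0 Mc)[c _ cmax] :
      {within M, continuous (fun m => enorm (m - y))}.
    by apply: continuous_subspaceT; exact: enorm_continuous.
  by exists (enorm (c - y)) => [|m Mm]; [exact: enorm_ge0|apply: cmax; rewrite inE].
have [d d0 dP] := bnd K l Kc K0; have [e e0 eP] := bnd L k Lc L0.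
exists (d + e + 1); first by lra.
by split=> y; [move/dP; exists l | move/eP; exists k] => //; lra.
Qed.

(** Nearest points exist by compactness, so the infimum that defines the distance is attained. The
    value [d = 0] is included, although the infimum runs over positive radii only. *)
Lemma hausdorff_leP K L (d : R) :
    compact K -> K !=set0 -> compact L -> L !=set0 -> 0 <= d ->
  hausdorff K L <= d <-> near_within K L d.
Proof.
move=> Kc K0 Lc L0 d0; rewrite /hausdorff; set S := [set _ | _].
have S0 : has_inf S.
  split; last by exists 0 => l [/ltW].
  by have [e e0 [KL LK]] := compact_near_within Kc K0 Lc L0; exists e.
split=> [Sd|[KL LK]].
  have close M N y : compact N -> N !=set0 -> M y ->
      (forall l, S l -> M `<=` parallel_body N l) -> parallel_body N d y.
    move=> Nc N0 My MN; have [m Nm mmin] := nearest y Nc N0; exists m => //.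
    apply/ler_addgt0Pr => e e0.
    have [l Sl le] := inf_adherent e0 S0.
    have [m' Nm' ym'] := MN l Sl _ My.
    by apply: le_trans (mmin _ Nm') _; lra.
  by split=> y ?; [apply: (close K)|apply: (close L)] => // l [? []].
apply/ler_addgt0Pr => e e0; apply: ge_inf; first exact: S0.2.
split; first by rewrite ltr_wpDl.
have dle : d <= d + e by lra.
by split=> y => [/KL|/LK] [m Mm ym]; exists m => //; exact: le_trans ym dle.
Qed.

Lemma hausdorff_ge K L (d : R) y :
    compact K -> K !=set0 -> compact L -> L !=set0 -> 0 < d ->
    K y -> (forall m, L m -> d <= enorm (y - m)) -> d <= hausdorff K L.
Proof.
move=> Kc K0 Lc L0 d0 Ky yL; rewrite leNgt; apply/negP => hd.
(* The maximum with 0 supplies the nonnegative bound that [hausdorff_leP] asks for. *)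
have h0 : 0 <= Num.max 0 (hausdorff K L) by rewrite le_max lexx.
have /(hausdorff_leP Kc K0 Lc L0 h0)[KL _] : hausdorff K L <= Num.max 0 (hausdorff K L).
  by rewrite le_max lexx orbT.
have [m Lm ym] := KL _ Ky; have := le_trans (yL _ Lm) ym.
by rewrite le_max !leNgt d0 hd.
Qed.

(** If neither body had such a point, [compact_parallel] would give, on both sides, a radius
    strictly below [d]. *)
Lemma hausdorff_far K L (d : R) :
    compact K -> K !=set0 -> compact L -> L !=set0 -> 0 < d ->
    d <= hausdorff K L ->
  (exists2 y, K y & forall m, L m -> d <= enorm (y - m)) \/
  (exists2 y, L y & forall m, K m -> d <= enorm (y - m)).
Proof.
move=> Kc K0 Lc L0 d0 dh; apply: contrapT => /not_orP[nK nL].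
have near M N : ~ (exists2 y, M y & forall m, N m -> d <= enorm (y - m)) ->
    forall y, M y -> exists2 m, N m & enorm (y - m) < d.
  move=> nMN y My; apply: contrapT => nm; apply: nMN; exists y => // m Nm.
  by rewrite leNgt; apply/negP => ?; apply: nm; exists m.
have [e1 e1d KL] := compact_parallel Kc K0 Lc L0 (near _ _ nK).
have [e2 e2d LK] := compact_parallel Lc L0 Kc K0 (near _ _ nL).
pose e := Num.max 0 (Num.max e1 e2).
have e0 : 0 <= e by rewrite le_max lexx.
have : hausdorff K L <= e.
  apply/hausdorff_leP => //; split=> y => [/KL|/LK] [m Mm ym]; exists m => //;
  by apply: le_trans ym _; rewrite !le_max lexx !orbT.
by rewrite leNgt (lt_le_trans _ dh) // !gt_max d0 e1d e2d.
Qed.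

End Hausdorff.

(** * Ball bodies *)

Section BallBodies.
Variables (R : realType) (n : nat).
Implicit Types (u v w x y z : 'rV[R]_n) (K L M A : set 'rV[R]_n).

Lemma ball_body_compact K : ball_body K -> compact K. Proof. by case=> [[]]. Qed.

Lemma ball_body_nonempty K : ball_body K -> K !=set0.
Proof. by case=> [[_ []]]. Qed.

Lemma ball_body_hausdorff_leP K L (d : R) : ball_body K -> ball_body L -> 0 <= d ->
  hausdorff K L <= d <-> near_within K L d.
Proof.
move=> bK bL; apply: hausdorff_leP;
  by [exact: ball_body_compact | exact: ball_body_nonempty].
Qed.

Lemma ball_body_hausdorff_ge K L (d : R) y : ball_body K -> ball_body L -> 0 < d ->
  K y -> (forall m, L m -> d <= enorm (y - m)) -> d <= hausdorff K L.
Proof.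
move=> bK bL; apply: hausdorff_ge;
  by [exact: ball_body_compact | exact: ball_body_nonempty].
Qed.

Lemma unit_ballP x y : unit_ball x y <-> dotp (y - x) (y - x) <= 1.
Proof. by rewrite /unit_ball /= enorm_le // expr1n. Qed.

Lemma unit_ball_center x : unit_ball x x.
Proof. by apply/unit_ballP; rewrite subrr dotp0l. Qed.

Lemma unit_ballC x y : unit_ball x y -> unit_ball y x.
Proof. by rewrite /unit_ball /= enormB. Qed.

Lemma enorm_normalize u : u != 0 ->
  exists v, [/\ dotp v v = 1, dotp u v = enorm u & u = enorm u *: v].
Proof.
move=> u0; have e0 : enorm u != 0.
  by apply: contra_neq u0 => e0; apply: enorm_eq0; rewrite e0.
exists ((enorm u)^-1 *: u); split.
- by rewrite !dotpE -sqr_enorm; field.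
- by rewrite !dotpE -sqr_enorm; field.
- by rewrite scalerA divff // scale1r.
Qed.

Lemma convex_unit_ball x : convex_set (unit_ball x).
Proof.
move=> y z t; rewrite !unit_ballP => xy xz t0 t1.
(* With [p = y - x] and [q = z - x], the bound follows from [|(1-t)p + tq|^2 = (1-t)|p|^2 + t|q|^2 -
   t(1-t)|p-q|^2]. *)
have -> : (1 - t) *: y + t *: z - x = (1 - t) *: (y - x) + t *: (z - x) by vec.
have h := dotp_ge0 (y - x - (z - x)).
have c := dotpC (y - x) (z - x).
have tt : 0 <= t * (1 - t) by rewrite mulr_ge0 // subr_ge0.
move: h xy xz c; move: (y - x) (z - x) => p q; rewrite !dotpE => h xy xz c.
have := mulr_ge0 tt h; have := ler_wpM2l t0 xz.
have s0 : 0 <= 1 - t by lra.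
by have := ler_wpM2l s0 xy; rewrite c; nra.
Qed.

Lemma ball_body_unit_ball x : ball_body (unit_ball x).
Proof.
split; last by exists [set x]; rewrite bigcap_set1.
split; first exact: unit_ball_compact.
by split; [exact: convex_unit_ball|exists x; exact: unit_ball_center].
Qed.

Lemma ball_body_set1 x : ball_body [set x].
Proof.
split.
  split; first exact: compact_set1.
  split; last by exists x.
  by move=> y z t -> -> _ _ /=; vec.
(* The centers are all points within 1 of [x]. A point [y] other than [x] is excluded by the ball
   centered at [x - v], where [v] is the unit direction from [x] to [y]. *)
exists (unit_ball x); apply/seteqP; split=> [y -> a /unit_ballC//|y yx].
apply: contrapT => nyx.
have /enorm_normalize[v [v1 yv _]] : y - x != 0 by rewrite subr_eq0; apply/eqP.
have /yx/unit_ballP : unit_ball x (x - v).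
  by apply/unit_ballP; rewrite (_ : x - v - x = - v) ?dotpNl ?dotpNr ?opprK ?v1 //; vec.
rewrite (_ : y - (x - v) = (y - x) + v); last by vec.
have : enorm (y - x) > 0.
  by rewrite lt_neqAle enorm_ge0 andbT eq_sym; apply/negP => /eqP e0;
     apply: nyx; apply/eqP; rewrite -subr_eq0; apply/eqP/enorm_eq0; rewrite e0.
move: yv (dotp_ge0 (y - x)); move: (y - x) => p yv pp p0.
by rewrite !dotpE (dotpC v p) yv v1; lra.
Qed.

Definition translate K w : set 'rV[R]_n := [set x | K (x - w)].

Lemma ball_body_translate K w : ball_body K -> ball_body (translate K w).
Proof.
move=> [[Kc [Kconv [k Kk]]] [A KA]]; split.
  split.
    have -> : translate K w = (fun x => x + w) @` K.
      apply/seteqP; split=> [x Kx|_ [y Ky <-]]; last by rewrite /translate /= addrK.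
      by exists (x - w) => //; rewrite subrK.
    apply: continuous_compact => //; apply: continuous_subspaceT => x.
    by apply: continuousD => //; exact: cst_continuous.
  split; last by exists (k + w); rewrite /translate /= addrK.
  move=> x y t Kx Ky t0 t1; rewrite /translate /=.
  by have := Kconv _ _ t Kx Ky t0 t1; congr K; vec.
exists (translate A w); rewrite /translate KA; apply/seteqP; split=> x /= Ax a.
  by move/Ax; rewrite /unit_ball /=; congr (enorm _ <= 1); vec.
move=> Aa; have := Ax (a + w); rewrite /= addrK => /(_ Aa).
by rewrite /unit_ball /=; congr (enorm _ <= 1); vec.
Qed.

(* If y were in the body but outside the ball, the point p + t(y - p) + r u with
   r = t(1-t)|y - p|^2/2 would still lie in every unit ball containing p and y,
   yet be higher than p in direction u for small t. *)
Lemma support_ball A u p :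
    dotp u u = 1 -> cdual A p ->
    (forall y, cdual A y -> dotp y u <= dotp p u) ->
  cdual A `<=` unit_ball (p - u).
Proof.
move=> u1 Ap pmax y Ay; apply/unit_ballP; rewrite leNgt; apply/negP.
rewrite (_ : y - (p - u) = (y - p) + u); last by vec.
have [d yE] : exists d, y = p + d by exists (y - p); rewrite addrC subrK.
rewrite {y}yE in Ay * => du.
have {du}sD : 0 < dotp d u + dotp d d / 2.
  move: du; rewrite (_ : p + d - p + u = d + u); last by vec.
  by rewrite !dotpE u1 (dotpC u d); lra.
have D0 : 0 < dotp d d.
  rewrite lt_neqAle dotp_ge0 andbT eq_sym; apply/eqP => D0.
  have d0 : d = 0 by apply: dotp_le0; rewrite D0.
  by move: sD; rewrite D0 d0 dotp0l; lra.
(* The gain in height is [t (s - t |d|^2 / 2)] with [s = dotp d u + |d|^2 / 2 > 0]; this [t] keeps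
   it at least [t s / 2]. *)
pose t := Num.min 1 ((dotp d u + dotp d d / 2) / dotp d d).
have t0 : 0 < t by rewrite lt_min ltr01 divr_gt0.
have t1 : t <= 1 by rewrite ge_min lexx.
have tD : t * dotp d d <= dotp d u + dotp d d / 2.
  by rewrite -ler_pdivlMr // ge_min lexx orbT.
pose r := t * (1 - t) * dotp d d / 2.
have tt : 0 <= t * (1 - t) by rewrite mulr_ge0 ?subr_ge0 // ltW.
have r0 : 0 <= r by rewrite /r; have := mulr_ge0 tt (ltW D0); lra.
have /pmax : cdual A (p + t *: d + r *: u).
  move=> c Ac; have /unit_ballP pc := Ap c Ac; have /unit_ballP yc := Ay c Ac.
  apply/unit_ballP.
  rewrite (_ : p + d - c = (p - c) + d) in yc; last by vec.
  rewrite (_ : p + t *: d + r *: u - c = (p - c) + t *: d + r *: u); last by vec.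
  move: (p - c) pc yc => e pc yc.
  have D4 : dotp d d <= 4.
    have := dotp_ge0 (e + (e + d)); rewrite !dotpE (dotpC d e) in yc *.
    by lra.
  have r1 : r <= 1.
    rewrite /r; have : t * (1 - t) <= 1 / 4 by have := sqr_ge0 (t - 1/2); nra.
    by nra.
  (* By strict convexity of the ball, [|e + t d|^2 <= 1 - t(1-t)|d|^2 = 1 - 2r <= (1-r)^2], which
     leaves room for the shift by [r u]. *)
  have etd : enorm (e + t *: d) <= 1 - r.
    rewrite enorm_le ?subr_ge0 //.
    rewrite !dotpE (dotpC d e) in yc *.
    have s0 : 0 <= 1 - t by lra.
    have := ler_wpM2l (ltW t0) yc; have := ler_wpM2l s0 pc.
    have := sqr_ge0 r; rewrite /r; nra.
  have : enorm (e + t *: d + r *: u) <= 1.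
    apply: le_trans (enormD _ _) _.
    by rewrite (enorm_unit_scale u1 r0); lra.
  by rewrite enorm_le // expr1n.
rewrite !dotpE u1 leNgt => /negP; apply.
have : 0 < t * (dotp d u + dotp d d / 2 - t * dotp d d / 2).
  by rewrite mulr_gt0 //; nra.
by rewrite /r; lra.
Qed.

(** By [support_ball] in the direction of [a - x], the body lies in the unit ball centered at the
    midpoint of [x] and [a]. This ball touches the sphere of radius 2 about [x] from inside, at [a]
    only. *)
Lemma sphere_contact_unique A x a b :
    cdual A a -> cdual A b ->
    dotp (a - x) (a - x) = 4 -> dotp (b - x) (b - x) = 4 ->
    (forall y, cdual A y -> dotp (y - x) (a - x) <= 4) -> a = b.
Proof.
move=> Aa Ab a4 b4 amax; apply/eqP; rewrite -subr_eq0; apply/eqP/dotp_le0.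
have u1 : dotp (2^-1 *: (a - x)) (2^-1 *: (a - x)) = 1 by rewrite dotpZl dotpZr a4; lra.
have h : forall y, cdual A y -> dotp y (2^-1 *: (a - x)) <= dotp a (2^-1 *: (a - x)).
  move=> y Ay; have := amax _ Ay; rewrite dotpZr dotpZr.
  have -> : dotp y (a - x) = dotp (y - x) (a - x) + dotp x (a - x).
    by rewrite -dotpDl subrK.
  have -> : dotp a (a - x) = dotp (a - x) (a - x) + dotp x (a - x).
    by rewrite -dotpDl subrK.
  by rewrite a4; lra.
have /unit_ballP := support_ball u1 Aa h Ab.
rewrite (_ : b - (a - 2^-1 *: (a - x)) = (b - x) - 2^-1 *: (a - x)); last by vec.
rewrite (_ : a - b = (a - x) - (b - x)); last by vec.
have ab := dotpC (a - x) (b - x).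
move: a4 b4 ab; move: (a - x) (b - x) => p q a4 b4 ab.
rewrite !dotpE a4 b4 ab; lra.
Qed.

Lemma obtuse_nearest M y m m' : convex_set M -> M m -> M m' ->
    (forall z, M z -> enorm (y - m) <= enorm (y - z)) ->
  dotp (y - m) (m' - m) <= 0.
Proof.
move=> Mconv Mm Mm' mmin; rewrite leNgt; apply/negP => P0.
have D0 := dotp_ge0 (m' - m).
(* With [P = dotp (y - m) (m' - m)] and [D = |m' - m|^2], the step [t = P / (P + D)] stays in [0, 1]
   whatever the size of [P]. It changes the squared distance to [y] by
   [-2tP + t^2 D = -tP - t^2 P < 0]. *)
pose t := dotp (y - m) (m' - m) / (dotp (y - m) (m' - m) + dotp (m' - m) (m' - m)).
have S0 : 0 < dotp (y - m) (m' - m) + dotp (m' - m) (m' - m) by lra.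
have t0 : 0 < t by rewrite divr_gt0.
have t1 : t <= 1 by rewrite ler_pdivrMr // mul1r; lra.
have tE : t * (dotp (y - m) (m' - m) + dotp (m' - m) (m' - m)) = dotp (y - m) (m' - m).
  by rewrite /t divfK // gt_eqF.
have := mmin _ (Mconv _ _ t Mm Mm' (ltW t0) t1).
rewrite enorm_ge ?enorm_ge0 // sqr_enorm.
rewrite (_ : y - ((1 - t) *: m + t *: m') = (y - m) - t *: (m' - m)); last by vec.
have c := dotpC (m' - m) (y - m).
move: c P0 D0 S0 t0 tE; move: (y - m) (m' - m) t t1 => p q t t1 c P0 D0 S0 t0 tE.
rewrite !dotpE c; have := mulr_gt0 t0 P0; nra.
Qed.

(** [cdual K] consists of the centers of all unit balls containing [K], and the centers in [A] are
    among them. *)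
Lemma cdual_cdual K : ball_body K -> cdual (cdual K) = K.
Proof.
move=> [_ [A ->]]; apply/seteqP; split=> [y cy a Aa|y Ay c cA].
  by apply: cy => z Az; apply: unit_ballC; exact: Az.
by apply: unit_ballC; exact: cA.
Qed.

Lemma ball_body_cover K u : dotp u u = 1 -> ball_body K ->
  exists p, [/\ K p, forall y, K y -> dotp y u <= dotp p u & K `<=` unit_ball (p - u)].
Proof.
move=> u1 bK; have [A KA] := bK.2.
have [p Kp pmax] := farthest u (ball_body_compact bK) (ball_body_nonempty bK).
by exists p; split=> //; rewrite KA in Kp pmax *; exact: support_ball.
Qed.

End BallBodies.

(** * Squares *)

Section Squares.
Variables (R : realType) (n : nat).
Implicit Types (a b c u v w x y z : 'rV[R]_n) (K L M A : set 'rV[R]_n).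

Definition in_ball2 K L := ball_body L /\ hausdorff K L <= 2.

Definition has_square K := exists L1 L2 L3 L4,
  [/\ [/\ in_ball2 K L1, in_ball2 K L2, in_ball2 K L3 & in_ball2 K L4],
      [/\ hausdorff L1 L2 = 4, hausdorff L2 L3 = 4, hausdorff L3 L4 = 4
        & hausdorff L4 L1 = 4], L1 <> L3 & L2 <> L4].

(** The upper bound is the triangle inequality through [K]; the lower bound comes from the point
    [y]. *)
Lemma edge_witness K L M y : ball_body K -> in_ball2 K L -> in_ball2 K M ->
  L y -> (forall m, M m -> 4 <= enorm (y - m)) -> hausdorff L M = 4.
Proof.
move=> bK [bL KL] [bM KM] Ly yM; apply: le_anti; apply/andP; split; last first.
  by apply: ball_body_hausdorff_ge yM.
apply/ball_body_hausdorff_leP => //; rewrite (_ : 4 = 2 + 2); last by lra.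
apply: (near_within_trans (L := K)); last by apply/ball_body_hausdorff_leP.
by apply: near_withinC; apply/ball_body_hausdorff_leP.
Qed.

(** The single point [p + 2u] witnesses all four edges: it lies in [K + 2u] and in the unit ball
    about [p + u], and has distance at least 4 from [p - 2u] and from all of [K - 2u]. *)
Lemma has_square_ball_body K u : dotp u u = 1 -> ball_body K ->
  (forall x, K <> [set x]) -> (forall x, K <> unit_ball x) -> has_square K.
Proof.
move=> u1 bK nK1 nKB; have [p [Kp pmax Kball]] := ball_body_cover u1 bK.
have u2 : enorm (2 *: u) = 2 by apply: enorm_unit_scale.
have uu : unit_ball 0 u by apply/unit_ballP; rewrite subr0 u1.
have d1 : in_ball2 K (translate K (2 *: u)).
  have bT := ball_body_translate (2 *: u) bK; split => //.
  apply/ball_body_hausdorff_leP => //; split=> y.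
    by move=> Ky; exists (y + 2 *: u);
      rewrite /translate /= ?addrK // opprD addrA subrr sub0r enormN u2.
  by move=> Ky; exists (y - 2 *: u) => //; rewrite opprD opprK addrA subrr add0r u2.
have d4 : in_ball2 K (translate K (- (2 *: u))).
  have bT := ball_body_translate (- (2 *: u)) bK; split => //.
  apply/ball_body_hausdorff_leP => //; split=> y.
    by move=> Ky; exists (y - 2 *: u);
      rewrite /translate /= ?addrK // opprD opprK addrA subrr add0r u2.
  by move=> Ky; exists (y - (- (2 *: u))) => //;
    rewrite opprD opprK addrA subrr sub0r enormN u2.
have d2 : in_ball2 K [set p - 2 *: u].
  have bT := ball_body_set1 (p - 2 *: u); split => //.
  apply/ball_body_hausdorff_leP => //; split=> y; last first.
    by move=> ->; exists p => //; rewrite addrAC subrr sub0r enormN u2.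
  move=> /Kball yp; exists (p - 2 *: u) => //.
  apply: le_trans (enorm_triangle (p - u) _ _) _.
  rewrite (_ : p - u - (p - 2 *: u) = 1 *: u); last by vec.
  by rewrite enorm_unit_scale //; move: yp; rewrite /unit_ball /=; lra.
have d3 : in_ball2 K (unit_ball (p + u)).
  have bT := ball_body_unit_ball (p + u); split => //.
  apply/ball_body_hausdorff_leP => //; split=> y.
    move=> /Kball yp; exists (y + 2 *: u); last first.
      by rewrite opprD addrA subrr sub0r enormN u2.
    by move: yp; rewrite /unit_ball /=; congr (enorm _ <= 1); vec.
  move=> yp; exists p => //.
  apply: le_trans (enorm_triangle (p + u) _ _) _.
  rewrite (_ : p + u - p = 1 *: u); last by vec.
  by rewrite enorm_unit_scale //; move: yp; rewrite /unit_ball /=; lra.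
have e12 m : [set p - 2 *: u] m -> 4 <= enorm (p + 2 *: u - m).
  move=> -> /=; rewrite (_ : _ - _ = 4 *: u); last by vec.
  by rewrite enorm_unit_scale.
have e34 m : translate K (- (2 *: u)) m -> 4 <= enorm (p + 2 *: u - m).
  (* In direction [u], the points of [K - 2u] are at least 4 lower than [p + 2u]; Cauchy-Schwarz
     turns this height gap into a distance. *)
  rewrite /translate /= opprK => /pmax h.
  have -> : 4 = dotp (4 *: u) u by rewrite dotpZl u1; lra.
  rewrite -[leRHS]mulr1.
  have e1 : enorm u = 1 by apply: enorm_eq; rewrite // u1 expr1n.
  rewrite -[X in _ <= _ * X]e1; apply: le_trans (dotp_le_enorm _ _).
  by move: h; rewrite !dotpE; lra.
have T1 : translate K (2 *: u) (p + 2 *: u) by rewrite /translate /= addrK.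
have T3 : unit_ball (p + u) (p + 2 *: u).
  by apply/unit_ballP; rewrite (_ : p + 2 *: u - (p + u) = u) ?u1 //; vec.
exists (translate K (2 *: u)), [set p - 2 *: u], (unit_ball (p + u)),
  (translate K (- (2 *: u))); split.
- by split.
- split.
  + exact: edge_witness bK d1 d2 T1 e12.
  + by rewrite hausdorffC; exact: edge_witness bK d3 d2 T3 e12.
  + exact: edge_witness bK d3 d4 T3 e34.
  + by rewrite hausdorffC; exact: edge_witness bK d1 d4 T1 e34.
- move=> KB; apply: (nKB (p - u)); apply/seteqP; split=> // y yB.
  have : unit_ball (p + u) (y + 2 *: u).
    by move: yB; rewrite /unit_ball /=; congr (enorm _ <= 1); vec.
  by rewrite -KB /translate /= addrK.
- move=> KB; apply: (nK1 p); apply/seteqP; split=> [y Ky|_ -> //].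
  have : translate K (- (2 *: u)) (y - 2 *: u) by rewrite /translate /= addrK.
  by rewrite -KB /= => /addIr.
Qed.

Lemma in_ball2_set1 x L y :
  in_ball2 [set x] L -> L y -> dotp (y - x) (y - x) <= 4.
Proof.
move=> [bL /(ball_body_hausdorff_leP (ball_body_set1 x) bL (ler0n _ 2))[_ Lx]].
by move=> /Lx[_ ->]; rewrite enorm_le //; lra.
Qed.

Lemma in_ball2_set1_contact_unique x L a b : in_ball2 [set x] L ->
    dotp (a - x) (a - x) = 4 -> dotp (b - x) (b - x) = 4 -> L a -> L b -> a = b.
Proof.
move=> dL a4 b4 La Lb; have [A LA] := dL.1.2; subst L.
apply: (sphere_contact_unique La Lb a4 b4) => y /(in_ball2_set1 dL).
have := dotp_ge0 ((y - x) - (a - x)); move: a4; move: (a - x) (y - x) => p q.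
by rewrite !dotpE (dotpC p q) => -> ; lra.
Qed.

(** With [p = y - x] and [q = m - x] of norm at most 2 and [|p - q| >= 4], the parallelogram law
    gives [|p + q|^2 <= 8 + 8 - 16 = 0], so every [m] in [M] is the reflection of [y] in [x]. *)
Lemma in_ball2_set1_antipodal x L M y :
    in_ball2 [set x] L -> in_ball2 [set x] M -> L y ->
    (forall m, M m -> 4 <= enorm (y - m)) ->
  dotp (x - y) (x - y) = 4 /\ M = [set x + x - y].
Proof.
move=> dL dM Ly yM.
have opp m : M m -> m = x + x - y.
  move=> Mm; have := yM _ Mm; rewrite enorm_ge // => ym.
  apply/eqP; rewrite -subr_eq0; apply/eqP/dotp_le0.
  rewrite (_ : m - (x + x - y) = (m - x) + (y - x)); last by vec.
  move: ym; rewrite (_ : y - m = (y - x) - (m - x)); last by vec.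
  have := in_ball2_set1 dL Ly; have := in_ball2_set1 dM Mm.
  by move: (y - x) (m - x) => p q; rewrite !dotpE (dotpC q p); lra.
have [m Mm] := ball_body_nonempty dM.1.
have mE := opp _ Mm; rewrite mE in Mm.
split; last by apply/seteqP; split=> [z /opp //|z ->].
have := yM _ Mm; rewrite enorm_ge //; have := in_ball2_set1 dM Mm.
rewrite (_ : y - (x + x - y) = - (2 *: (x - y))); last by vec.
rewrite (_ : x + x - y - x = x - y); last by vec.
by rewrite dotpNl dotpNr dotpZl dotpZr; lra.
Qed.

Lemma in_ball2_set1_edge x L M :
    in_ball2 [set x] L -> in_ball2 [set x] M -> hausdorff L M = 4 ->
  exists2 a, dotp (a - x) (a - x) = 4 &
    (L = [set a] /\ M (x + x - a)) \/ (M = [set a] /\ L (x + x - a)).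
Proof.
move=> dL dM LM4.
have edge N P y : in_ball2 [set x] N -> in_ball2 [set x] P -> N y ->
    (forall m, P m -> 4 <= enorm (y - m)) ->
    exists2 a, dotp (a - x) (a - x) = 4 & P = [set a] /\ N (x + x - a).
  move=> dN dP Ny yP; have [y4 PE] := in_ball2_set1_antipodal dN dP Ny yP.
  exists (x + x - y); first by rewrite (_ : _ - x = x - y) //; vec.
  by split; rewrite // opprB addrC subrK.
have /hausdorff_far : 4 <= hausdorff L M by rewrite LM4.
have [cL cM] := (ball_body_compact dL.1, ball_body_compact dM.1).
have [L0 M0] := (ball_body_nonempty dL.1, ball_body_nonempty dM.1).
case=> // -[y yL yM].
  by have [a a4 aP] := edge _ _ _ dL dM yL yM; exists a => //; right.
by have [a a4 aP] := edge _ _ _ dM dL yL yM; exists a => //; left.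
Qed.

(** Every edge has an end in [S], a singleton on the sphere, so two opposite vertices are in [S]. A
    common neighbor of [{a}] and [{b}] contains the antipodes of [a] and [b]; since it meets the
    sphere at most once, [a = b]. *)
Lemma not_has_square_set1 x : ~ has_square [set x].
Proof.
move=> [L1 [L2 [L3 [L4 [[d1 d2 d3 d4] [e12 e23 e34 e41] n13 n24]]]]].
pose S L := exists2 a, dotp (a - x) (a - x) = 4 & L = [set a].
have edgeS L M : in_ball2 [set x] L -> in_ball2 [set x] M -> hausdorff L M = 4 ->
    S L \/ S M.
  move=> dL dM /(in_ball2_set1_edge dL dM)[a a4 [[La _]|[Ma _]]].
    by left; exists a.
  by right; exists a.
have edge1 a M : in_ball2 [set x] [set a] -> in_ball2 [set x] M ->
    hausdorff [set a] M = 4 -> M (x + x - a).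
  move=> da dM /(in_ball2_set1_edge da dM)[b b4 [[ab bM]|[-> /= <-]]].
    by have -> : a = b by have : [set a] a by []; rewrite ab.
  by rewrite opprB addrC subrK.
have opposite L L' M : in_ball2 [set x] L -> in_ball2 [set x] L' ->
    in_ball2 [set x] M -> hausdorff L M = 4 -> hausdorff M L' = 4 ->
    S L -> S L' -> L = L'.
  move=> dL dL' dM LM ML' [a a4 La] [b b4 Lb].
  rewrite La Lb in dL dL' LM ML' *; rewrite hausdorffC in ML'.
  have refl c : dotp (c - x) (c - x) = 4 ->
      dotp (x + x - c - x) (x + x - c - x) = 4.
    by rewrite (_ : x + x - c - x = - (c - x)) ?dotpNl ?dotpNr ?opprK //; vec.
  have := in_ball2_set1_contact_unique dM (refl _ a4) (refl _ b4)
    (edge1 _ _ dL dM LM) (edge1 _ _ dL' dM ML').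
  by move=> /addrI/oppr_inj ->.
have [s1|n1] := pselect (S L1); last first.
  have [//|s2] := edgeS _ _ d1 d2 e12; have [s4|//] := edgeS _ _ d4 d1 e41.
  exact: n24 (opposite _ _ _ d2 d4 d3 e23 e34 s2 s4).
have [s3|n3] := pselect (S L3).
  exact: n13 (opposite _ _ _ d1 d3 d2 e12 e23 s1 s3).
have [s2|//] := edgeS _ _ d2 d3 e23; have [//|s4] := edgeS _ _ d3 d4 e34.
exact: n24 (opposite _ _ _ d2 d4 d3 e23 e34 s2 s4).
Qed.

End Squares.

(** * Distances to points and unit balls, rigid motions *)

Section Distances.
Variables (R : realType) (n : nat).
Implicit Types (a b c u v w x y z : 'rV[R]_n) (K L M A : set 'rV[R]_n).

Lemma hausdorff_eq K L (e : R) : ball_body K -> ball_body L -> 0 <= e ->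
  (forall d, 0 <= d -> near_within K L d <-> e <= d) -> hausdorff K L = e.
Proof.
move=> bK bL e0 h; apply: le_anti; apply/andP; split.
  by apply/ball_body_hausdorff_leP => //; apply/h.
have h0 : 0 <= hausdorff K L.
  apply: lb_le_inf => [|d [/ltW]//].
  have [d d0 [KL LK]] := compact_near_within (ball_body_compact bK)
    (ball_body_nonempty bK) (ball_body_compact bL) (ball_body_nonempty bL).
  by exists d.
by apply/(h _ h0)/ball_body_hausdorff_leP.
Qed.

Lemma hausdorff_set1 a b : hausdorff [set a] [set b] = enorm (a - b).
Proof.
apply: hausdorff_eq; [exact: ball_body_set1|exact: ball_body_set1|exact: enorm_ge0|].
move=> d d0; split=> [[/(_ a erefl)[_ -> //]]|abd].
by split=> _ ->; [exists b|exists a; rewrite // enormB].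
Qed.

Lemma hausdorff_unit_ball a b : hausdorff (unit_ball a) (unit_ball b) = enorm (a - b).
Proof.
apply: hausdorff_eq; [exact: ball_body_unit_ball|exact: ball_body_unit_ball|
  exact: enorm_ge0|].
have shift p q z : unit_ball p z -> unit_ball q (z - (p - q)).
  by rewrite /unit_ball /=; congr (enorm _ <= 1); vec.
have shiftd p q z : enorm (z - (z - (p - q))) = enorm (p - q).
  by congr enorm; vec.
move=> d d0; split=> [[abd _]|abd]; last first.
  by split=> z /shift pz; [exists (z - (a - b))|exists (z - (b - a))];
     rewrite ?shiftd // enormB.
have [ab0|ab0] := eqVneq (a - b) 0; first by rewrite ab0 enorm0.
have [v [v1 abv _]] := enorm_normalize ab0.
(* The point [a + v] of the first ball is the farthest from [b], at distance [|a - b| + 1]. *)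
have [|z bz zd] := abd (a + v).
  by apply/unit_ballP; rewrite addrAC subrr add0r v1.
rewrite -(lerD2r 1); apply: le_trans (_ : enorm (a + v - b) <= _); last first.
  by apply: le_trans (enorm_triangle z _ _) _; move: bz; rewrite /unit_ball /=; lra.
have ev : enorm v = 1 by apply: enorm_eq; rewrite // v1 expr1n.
rewrite -[leRHS]mulr1 -ev; apply: le_trans (dotp_le_enorm _ _).
by rewrite (addrAC a) (dotpDl (a - b)) v1 abv ev.
Qed.

(** The antipodal points [b + u] and [b - u] are 2 apart, so they cannot both be at distance less
    than 1 from [a]. *)
Lemma hausdorff_set1_unit_ball u a b : dotp u u = 1 ->
  1 <= hausdorff [set a] (unit_ball b).
Proof.
move=> u1; rewrite leNgt; apply/negP => hlt.
have [d d1 hd] : exists2 d, 0 <= d < 1 & hausdorff [set a] (unit_ball b) <= d.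
  exists (Num.max 0 (hausdorff [set a] (unit_ball b))); last by rewrite le_max lexx orbT.
  by rewrite le_max lexx gt_max ltr01.
have [d0 {}d1] := andP d1.
have /(ball_body_hausdorff_leP (ball_body_set1 a) (ball_body_unit_ball b) d0)[_ near] := hd.
have [|_ -> h1] := near (b + u).
  by apply/unit_ballP; rewrite addrAC subrr add0r u1.
have [|_ -> h2] := near (b - u).
  by apply/unit_ballP; rewrite addrAC subrr add0r dotpNl dotpNr u1 opprK.
have : enorm (2 *: u) <= d + d.
  rewrite (_ : 2 *: u = (b + u) - (b - u)); last by vec.
  by apply: le_trans (enorm_triangle a _ _) _; rewrite (enormB a); lra.
by rewrite enorm_unit_scale //; lra.
Qed.

Lemma hausdorff_set1_le1 x K : ball_body K -> hausdorff [set x] K <= 1 <-> cdual K x.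
Proof.
move=> bK; rewrite ball_body_hausdorff_leP //; last exact: ball_body_set1.
split=> [[_ Kx] y /Kx[_ ->]|Kx]; first by rewrite /unit_ball /= enormB.
split=> [_ ->|y Ky]; last by exists x => //; exact: unit_ballC (Kx _ Ky).
by have [k Kk] := ball_body_nonempty bK; exists k => //; exact: Kx.
Qed.

(** This expresses membership in a ball body by distances alone, as [hausdorff_set1_le1] does for
    membership in the dual. *)
Lemma hausdorff_unit_ball_le1 u x M : dotp u u = 1 -> ball_body M ->
  hausdorff (unit_ball x) M <= 1 <-> M x.
Proof.
move=> u1 bM; rewrite ball_body_hausdorff_leP //; last exact: ball_body_unit_ball.
split=> [[xM _]|Mx].
  have [m Mm mmin] := nearest x (ball_body_compact bM) (ball_body_nonempty bM).
  have [/eqP|xm0] := eqVneq (x - m) 0; first by rewrite subr_eq0 => /eqP ->.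
  have [v [v1 xmv xmE]] := enorm_normalize xm0.
  have e0 : 0 < enorm (x - m).
    rewrite lt_neqAle enorm_ge0 andbT eq_sym; apply: contra_neq xm0 => e0.
    by rewrite xmE e0 scale0r.
  (* If [x] were outside [M], pushing it by 1 away from its nearest point [m] would give a point at
     distance at least [|x - m| + 1] from [M], as [M] lies behind the hyperplane through [m]
     orthogonal to [v]. *)
  have [|m' Mm' xm'] := xM (x + v).
    by apply/unit_ballP; rewrite addrAC subrr add0r v1.
  have := obtuse_nearest bM.1.2.1 Mm Mm' mmin; rewrite xmE dotpZl pmulr_rle0 // => h.
  have := dotp_le_enorm (x + v - m') v.
  have ev : enorm v = 1 by apply: enorm_eq; rewrite // v1 expr1n.
  rewrite (_ : x + v - m' = (x - m) - (m' - m) + v) in xm' *; last by vec.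
  rewrite (dotpDl _ v) (dotpDl (x - m)) dotpNl (dotpC (m' - m)) xmv v1 ev mulr1.
  by move: h xm' e0; lra.
(* Since [M] lies in some unit ball, [|x - y| <= 2] for [y] in [M], and the midpoint of [x] and [y]
   is within 1 of both. *)
have [p [_ _ Mp]] := ball_body_cover u1 bM.
split=> y; first by move=> xy; exists x.
move=> My; exists (2^-1 *: (x + y)); have := Mp _ My; have := Mp _ Mx.
  rewrite !unit_ballP.
  rewrite (_ : 2^-1 *: (x + y) - x = 2^-1 *: ((y - (p - u)) - (x - (p - u)))); last by vec.
  have := dotp_ge0 ((y - (p - u)) + (x - (p - u))).
  move: (y - (p - u)) (x - (p - u)) => q r; rewrite !dotpE (dotpC r q); lra.
rewrite !unit_ballP enorm_le // expr1n.
rewrite (_ : y - 2^-1 *: (x + y) = 2^-1 *: ((y - (p - u)) - (x - (p - u)))); last by vec.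
have := dotp_ge0 ((y - (p - u)) + (x - (p - u))).
move: (y - (p - u)) (x - (p - u)) => q r; rewrite !dotpE (dotpC r q); lra.
Qed.

(** Subtracting [g 0] gives a map [f] that preserves norms, hence inner products by polarization. If
    [U] has the images of the basis vectors as rows, the coordinates of [x] are the products of
    [f x] with these rows, so [f x *m U^T = x]; linearity follows from this. *)
Lemma isometry_rigid_motion (g : 'rV[R]_n -> 'rV[R]_n) :
  (forall x y, enorm (g x - g y) = enorm (x - y)) -> rigid_motion g.
Proof.
move=> giso; have [f fE] : exists f, forall x, f x = g x - g 0.
  by exists (fun x => g x - g 0).
have dist x y : dotp (f x - f y) (f x - f y) = dotp (x - y) (x - y).
  by rewrite -!sqr_enorm -(giso x y); congr (enorm _ ^+ 2); rewrite !fE; vec.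
have f0 : f 0 = 0 by rewrite fE subrr.
have fn x : dotp (f x) (f x) = dotp x x by have := dist x 0; rewrite f0 !subr0.
have fdot x y : dotp (f x) (f y) = dotp x y.
  have := dist x y; rewrite !dotpE !fn (dotpC (f y)) (dotpC y); lra.
have dotp_delta x j : dotp x (delta_mx 0 j) = x 0 j.
  rewrite /dotp (bigD1 j) //= mxE !eqxx mulr1 big1 ?addr0 // => i /negbTE ij.
  by rewrite mxE eqxx ij mulr0.
pose U := \matrix_(i, j) f (delta_mx 0 i) 0 j.
have mulUT x : f x *m U^T = x.
  apply/rowP => i; rewrite -[RHS]dotp_delta -fdot mxE.
  by apply: eq_bigr => j _; rewrite !mxE.
have UU : U *m U^T = 1%:M.
  apply/row_matrixP => i; rewrite row_mul.
  have -> : row i U = f (delta_mx 0 i) by apply/rowP => j; rewrite !mxE.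
  by rewrite mulUT row1.
exists U, (g 0); split=> // x.
by rewrite -[in RHS](mulUT x) -mulmxA (mulmx1C UU) mulmx1 fE subrK.
Qed.

Lemma rigid_motion_surj (g : 'rV[R]_n -> 'rV[R]_n) :
  rigid_motion g -> forall y, exists x, g x = y.
Proof.
move=> [U [b [UU gE]]] y; exists ((y - b) *m U^T).
by rewrite gE -mulmxA (mulmx1C UU) mulmx1 subrK.
Qed.

End Distances.

(** * Isometries *)

Section IsometriesOfBallBodies.
Variables (R : realType) (n : nat) (T : set 'rV[R]_n -> set 'rV[R]_n).
Hypothesis hmaps : forall K, ball_body K -> ball_body (T K).
Hypothesis hsurj : forall L, ball_body L -> exists2 K, ball_body K & T K = L.
Hypothesis hiso : forall K L, ball_body K -> ball_body L ->
  hausdorff (T K) (T L) = hausdorff K L.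
Variable u : 'rV[R]_n.
Hypothesis u1 : dotp u u = 1.

(** The vertices pull back by surjectivity of [T], and the isometry keeps all distances. *)
Lemma has_square_preimage K : ball_body K -> has_square (T K) -> has_square K.
Proof.
move=> bK [L1 [L2 [L3 [L4 [[d1 d2 d3 d4] [e12 e23 e34 e41] n13 n24]]]]].
have pull L : in_ball2 (T K) L -> exists2 M, in_ball2 K M & T M = L.
  move=> [bL KL]; have [M bM ML] := hsurj bL; exists M => //.
  by split; rewrite // -hiso // ML.
have [M1 D1 E1] := pull _ d1; have [M2 D2 E2] := pull _ d2.
have [M3 D3 E3] := pull _ d3; have [M4 D4 E4] := pull _ d4.
have iso4 M M' : in_ball2 K M -> in_ball2 K M' -> hausdorff (T M) (T M') = 4 ->
    hausdorff M M' = 4.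
  by move=> [bM _] [bM' _]; rewrite hiso.
subst L1 L2 L3 L4.
exists M1, M2, M3, M4; split.
- by split.
- by split; apply: iso4.
- by move=> E; apply: n13; rewrite E.
- by move=> E; apply: n24; rewrite E.
Qed.

Lemma point_or_unit_ball x :
  (exists a, T [set x] = [set a]) \/ (exists a, T [set x] = unit_ball a).
Proof.
apply: contrapT => /not_orP[n1 n2].
apply: (@not_has_square_set1 _ _ x); apply: has_square_preimage.
  exact: ball_body_set1.
apply: (has_square_ball_body u1); first exact/hmaps/ball_body_set1.
  by move=> a Ta; apply: n1; exists a.
by move=> a Ta; apply: n2; exists a.
Qed.

(** An image of [{y}] that is a unit ball would be at distance at least 1 from the point [a]. *)
Lemma point_near x y a : enorm (x - y) < 1 -> T [set x] = [set a] ->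
  exists b, T [set y] = [set b].
Proof.
move=> xy Tx; have [//|[b Ty]] := point_or_unit_ball y.
have := @hausdorff_set1_unit_ball _ _ _ a b u1.
by rewrite -Tx -Ty hiso ?hausdorff_set1; [rewrite leNgt xy|exact: ball_body_set1..].
Qed.

(* The dichotomy is constant on small segments; longer ones are halved. *)
Lemma point_everywhere x y a : T [set x] = [set a] -> exists b, T [set y] = [set b].
Proof.
have step k : forall x y a, enorm (x - y) < 2 ^+ k -> T [set x] = [set a] ->
    exists b, T [set y] = [set b].
  elim: k => [|k IHk] p q c; first by rewrite expr0; exact: point_near.
  move=> pq Tp; pose m := 2^-1 *: (p + q).
  have half : enorm (2^-1 *: (p - q)) < 2 ^+ k.
    have -> : enorm (2^-1 *: (p - q)) = 2^-1 * enorm (p - q).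
      apply: enorm_eq; first by rewrite mulr_ge0 ?enorm_ge0 // invr_ge0.
      by rewrite !(dotpZl, dotpZr) exprMn sqr_enorm; lra.
    by move: pq; rewrite exprS; lra.
  have [|b Tm] := IHk p m c _ Tp.
    by rewrite (_ : p - m = 2^-1 *: (p - q)) // /m; vec.
  by apply: IHk Tm; rewrite (_ : m - q = 2^-1 *: (p - q)) // /m; vec.
(* The exponent works because [r < k <= 2^k] for [k = truncn r + 1]. *)
apply: (step (Num.truncn (enorm (x - y))).+1).
apply: lt_le_trans (truncnS_gt _) _.
by rewrite -natrX ler_nat ltnW // ltn_expl.
Qed.

End IsometriesOfBallBodies.

Unset Implicit Arguments.

Theorem theorem1 (R : realType) (n : nat) (hn : (0 < n)%N)
  (T : set 'rV[R]_n -> set 'rV[R]_n)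
  (hmaps : forall K, ball_body K -> ball_body (T K))
  (hinj : forall K L, ball_body K -> ball_body L -> T K = T L -> K = L)
  (hsurj : forall L, ball_body L -> exists2 K, ball_body K & T K = L)
  (hiso : forall K L, ball_body K -> ball_body L ->
            hausdorff (T K) (T L) = hausdorff K L) :
  exists g : 'rV[R]_n -> 'rV[R]_n, rigid_motion g /\
    ((forall K, ball_body K -> T K = g @` K) \/
     (forall K, ball_body K -> T K = g @` cdual K)).
Proof.
have [u u1] : exists u : 'rV[R]_n, dotp u u = 1.
  exists (delta_mx 0 (Ordinal hn)); rewrite /dotp (bigD1 (Ordinal hn)) //=.
  rewrite !mxE !eqxx mulr1 big1 ?addr0 // => i /negbTE i0.
  by rewrite !mxE i0 andbF mulr0.
have bpt (x : 'rV[R]_n) := ball_body_set1 x.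
have [[x [a Ta]]|nopt] := pselect (exists x a, T [set x] = [set a]).
  have /choice[g gE] : forall y, exists b, T [set y] = [set b].
    by move=> y; exact: (point_everywhere hmaps hsurj hiso u1 y Ta).
  have grigid : rigid_motion g.
    by apply: isometry_rigid_motion => y z; rewrite -!hausdorff_set1 -!gE hiso.
  exists g; split=> //; left => K bK.
  (* Membership in the dual is the metric condition of distance at most 1 from a singleton, which
     [T] preserves. *)
  have dualP c : cdual (T K) (g c) <-> cdual K c.
    by rewrite -!hausdorff_set1_le1 -?gE ?hiso //; exact: hmaps.
  have memP y : T K (g y) <-> K y.
    have giso c : unit_ball (g c) (g y) <-> unit_ball c y.
      by rewrite /unit_ball /= -!hausdorff_set1 -!gE hiso.
    (* Both sides become membership in all unit balls centered in the dual. As [g] is onto, every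
       center for [T K] is some [g c'] with [c'] a center for [K]. *)
    rewrite -(cdual_cdual (hmaps _ bK)) -{2}(cdual_cdual bK); split=> yK c.
      by move=> /dualP/yK/giso.
    by have [c' <-] := rigid_motion_surj grigid c => /dualP/yK/giso.
  apply/seteqP; split=> [y|_ [y Ky <-]]; last exact/memP.
  by have [y' <-] := rigid_motion_surj grigid y => /memP Ky'; exists y'.
have /choice[g gE] : forall y, exists b, T [set y] = unit_ball b.
  move=> y; have [[b Tb]|//] := point_or_unit_ball hmaps hsurj hiso u1 y.
  by case: nopt; exists y, b.
have grigid : rigid_motion g.
  apply: isometry_rigid_motion => y z.
  by rewrite -hausdorff_unit_ball -hausdorff_set1 -!gE hiso.
exists g; split=> //; right => K bK.
(* The unit ball about [g y] is the image of [{y}], so its distance to [T K] equals that of [{y}] to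
   [K]. *)
have memP y : T K (g y) <-> cdual K y.
  rewrite -(hausdorff_unit_ball_le1 _ u1 (hmaps _ bK)) -gE hiso //.
  exact: hausdorff_set1_le1.
apply/seteqP; split=> [y|_ [y Ky <-]]; last exact/memP.
by have [y' <-] := rigid_motion_surj grigid y => /memP Ky'; exists y'.
Qed.
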